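(* Let $\mathcal{M}^{n-1}_{n,n}\subset\mathcal{C}^{n\times n}$ be the variety of singular $n\times n$ matrices. If $M\in\mathbb{R}^{n\times n}$ is a matrix for which the minimum in the tropical determinant $\min_{\sigma\in S_n}\left(M_{1\sigma(1)}+\dots+M_{n\sigma(n)}\right)$ is achieved at two permutations $\sigma_1,\sigma_2$ of opposite signs, then $M$ has a lift to a singular $n\times n$ matrix whose entries are real positive Puiseux series, i.e. $M\in\mathrm{trop}_{\mathcal{R}^+}(\mathcal{M}^{n-1}_{n,n})$. That is, $$\mathrm{trop}_{\mathcal{C}^+}(\mathcal{M}^{n-1}_{n,n})=\mathrm{trop}_{\mathcal{R}^+}(\mathcal{M}^{n-1}_{n,n}).$$
   Context: Let $\mathcal{C}=\mathbb{C}\{\!\{t\}\!\}$ and $\mathcal{R}=\mathbb{R}\{\!\{t\}\!\}$ be the fields of complex and real Puiseux series, with valuation $\mathrm{val}(a)$ = the exponent of the lowest degree term of $a\ne0$. Let $\mathcal{C}^+\subset\mathcal{C}$ and $\mathcal{R}^+\subset\mathcal{R}$ be the subsets of nonzero series whose leading coefficient is a positive real number. For a variety $X\subset\mathcal{C}^N$ define $\mathrm{trop}_{\mathcal{C}^+}(X)=\overline{\{\mathrm{val}(x): x\in X\cap(\mathcal{C}^+)^N\}}$ and $\mathrm{trop}_{\mathcal{R}^+}(X)=\overline{\{\mathrm{val}(x): x\in X\cap(\mathcal{R}^+)^N\}}$, subsets of $\mathbb{R}^N$, with coordinatewise valuation and Euclidean closure. ''$M$ has a lift to a singular matrix of real positive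 Puiseux series'' is understood as $M\in\mathrm{trop}_{\mathcal{R}^+}(\mathcal{M}^{n-1}_{n,n})$ (i.e. $M$ is, up to Euclidean closure, the entrywise valuation of a singular matrix with entries in $\mathcal{R}^+$). *)

(* Defs.v *)
From HB Require Import structures.
From mathcomp Require Export all_boot all_order all_algebra all_fingroup.
From mathcomp Require Export complex.
From mathcomp Require Export mathcomp_extra boolp classical_sets functions.
From mathcomp Require Export cardinality fsbigop reals topology normedtype.
From mathcomp Require Import ring lra zify.

Set Implicit Arguments.
Unset Strict Implicit.
Unset Printing Implicit Defensive.

Import Order.TTheory GRing.Theory Num.Theory.
Import numFieldNormedType.Exports.

Local Open Scope classical_set_scope.
Local Open Scope ring_scope.

(* A Puiseux series over K is given by its coefficients: f q is the coefficient
   of t ^ q. The exponents must have a common denominator and a lower bound. *)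
Definition puiseux_support (K : fieldType) (f : rat -> K) : Prop :=
  exists (d : nat) (m : int), (0 < d)%N /\
    forall q : rat, f q != 0 ->
      exists2 k : int, (m <= k)%R & q = k%:~R / d%:R.

Record puiseux (K : fieldType) : Type := Puiseux {
  pcoef :> rat -> K;
  pcoefP : puiseux_support pcoef }.

(* Convolution; the sum is finitely supported when f and g are Puiseux
   series. *)
Definition pconv (K : fieldType) (f g : rat -> K) (q : rat) : K :=
  \sum_(a \in [set: rat]) (f a * g (q - a)).

Lemma puiseux_eqP (K : fieldType) (f g : puiseux K) :
  (forall q, f q = g q) -> f = g.
Proof.
case: f g => [f fP] [g gP] /= fg.
have e : f = g by apply/funext.
by subst g; congr Puiseux; exact: Prop_irrelevance.
Qed.

Section Support.
Variable K : fieldType.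
Implicit Types (f g h : rat -> K) (u v w : rat) (d : nat) (a b c : nat -> K).

Let supp v d f := forall q, f q != 0 -> exists k : nat, q = v + k%:R / d%:R.

Let supp_intro (m : int) d f : (0 < d)%N -> supp (m%:~R / d%:R) d f ->
  puiseux_support f.
Proof.
move=> d0 fs; exists d, m; split=> // q /fs[k ->].
exists (m + k%:Z); first by rewrite lerDl.
by rewrite intrD mulrDl.
Qed.

Let supp_refine (m n : int) d e f : (0 < d)%N -> (0 < e)%N ->
  (n <= m * e%:Z)%R ->
  (forall q : rat, f q != 0 ->
      exists2 k : int, (m <= k)%R & q = k%:~R / d%:R) ->
  supp (n%:~R / (d * e)%N%:R) (d * e) f.
Proof.
move=> d0 e0 nm fs q /fs[k mk ->].
have nk : (n <= k * e%:Z)%R by nia.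
exists `|(k * e%:Z - n)%R|%N.
have -> : (`|(k * e%:Z - n)%R|%N)%:R = (k * e%:Z - n)%:~R :> rat.
  by rewrite [LHS]pmulrn gez0_abs // subr_ge0.
have d0' : d%:R != 0 :> rat by rewrite pnatr_eq0 -lt0n.
have e0' : e%:R != 0 :> rat by rewrite pnatr_eq0 -lt0n.
rewrite intrD intrN intrM natrM -pmulrn.
by field; rewrite d0' e0'.
Qed.

Let supp3 f g h : puiseux_support f -> puiseux_support g ->
  puiseux_support h -> exists (m : int) d, (0 < d)%N /\
  [/\ supp (m%:~R / d%:R) d f, supp (m%:~R / d%:R) d g
    & supp (m%:~R / d%:R) d h].
Proof.
move=> [d [m [d0 fs]]] [e [n [e0 gs]]] [r [p [r0 hs]]].
pose M : int := - (`|m| * (e * r)%N%:Z + `|n| * (d * r)%N%:Z +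
  `|p| * (d * e)%N%:Z).
exists M, (d * e * r)%N; split; first by rewrite !muln_gt0 d0 e0 r0.
have H (x y z : int) (i j k : nat) :
    (- (`|x| * i%:Z + `|y| * j%:Z + `|z| * k%:Z) <= x * i%:Z)%R.
  have : (0 <= `|y| * j%:Z)%R by rewrite mulr_ge0.
  have : (0 <= `|z| * k%:Z)%R by rewrite mulr_ge0.
  have : (- (`|x| * i%:Z) <= x * i%:Z)%R.
    by rewrite -mulNr ler_wpM2r // lerNl ler_normr lexx orbT.
  lia.
split.
- rewrite -mulnA; apply: (supp_refine _ _ _ fs) => //.
    by rewrite muln_gt0 e0.
  exact: H.
- rewrite mulnAC mulnC.
  apply: (supp_refine _ _ _ gs) => //; first by rewrite muln_gt0 d0.
  by rewrite /M [X in - (X + _)]addrC; exact: H.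
- rewrite mulnC.
  apply: (supp_refine _ _ _ hs) => //; first by rewrite muln_gt0 d0.
  by rewrite /M addrC addrA; exact: H.
Qed.

Let shift_inj v d : (0 < d)%N -> injective (fun k : nat => v + k%:R / d%:R).
Proof.
move=> d0 i j /addrI /mulIf e.
by apply/eqP; rewrite -(eqr_nat rat) e // invr_eq0 pnatr_eq0 -lt0n.
Qed.

Let pconvE v w d f g (k : nat) : (0 < d)%N -> supp v d f -> supp w d g ->
  pconv f g (v + w + k%:R / d%:R) =
  \sum_(i < k.+1) f (v + i%:R / d%:R) * g (w + (k - i)%:R / d%:R).
Proof.
move=> d0 fs gs; rewrite /pconv.
pose F i := f (v + i%:R / d%:R) * g (w + (k - i)%:R / d%:R).
rewrite (fsbig_ord _ k.+1 F).
rewrite -(fsbig_widen [set v + (i : nat)%:R / d%:R | i in `I_k.+1]) //.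
- rewrite fsbig_image; last by move=> x y _ _; exact: shift_inj.
  apply: eq_fsbigr => i; rewrite inE /= ltnS => ik; rewrite /F natrB //.
  by congr (_ * g _); ring.
- move=> a [_ na] /=; apply/eqP; apply: contrapT => /negP.
  rewrite mulf_eq0 negb_or => /andP[/fs[i ai] /gs[j bj]]; apply: na.
  exists i => //=; rewrite ltnS.
  have : (i + j)%N = k; last by move=> <-; rewrite leq_addr.
  apply: (@shift_inj (v + w) d) => //=.
  by rewrite natrD mulrDl; move: bj; rewrite ai => bj; lra.
Qed.

Let pconv_supp v w d f g : supp v d f -> supp w d g ->
  supp (v + w) d (pconv f g).
Proof.
move=> fs gs q nz; apply: contrapT => nq; move: nz.
rewrite /pconv fsbig1 ?eqxx // => a _; apply/eqP; apply: contrapT => /negP.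
rewrite mulf_eq0 negb_or => /andP[/fs[i ai] /gs[j bj]]; apply: nq.
by exists (i + j)%N; rewrite natrD; move: bj; rewrite ai => bj; lra.
Qed.

Let supp_ext u d f g : (0 < d)%N -> supp u d f -> supp u d g ->
  (forall k : nat, f (u + k%:R / d%:R) = g (u + k%:R / d%:R)) -> f = g.
Proof.
move=> d0 fs gs fg; apply/funext => q.
have [fq|/fs[k ->]//] := eqVneq (f q) 0.
have [gq|/gs[k ->]//] := eqVneq (g q) 0.
by rewrite fq gq.
Qed.

Let conv a b k := \sum_(i < k.+1) a i * b (k - i)%N.

Let convC a b k : conv a b k = conv b a k.
Proof.
rewrite /conv (reindex_inj rev_ord_inj) /=; apply: eq_bigr => i _.
by rewrite subSS mulrC subKn // -ltnS.
Qed.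

Let conv_poly a b N k : (k < N)%N ->
  conv a b k = ((\poly_(i < N) a i) * (\poly_(i < N) b i))`_k.
Proof.
move=> kN; rewrite coefM; apply: eq_bigr => i _.
rewrite !coef_poly (leq_ltn_trans _ kN) ?leq_ord //.
by rewrite (leq_ltn_trans _ kN) ?leq_subr.
Qed.

Let convA a b c k : conv a (conv b c) k = conv (conv a b) c k.
Proof.
set P := \poly_(i < k.+1) a i; set Q := \poly_(i < k.+1) b i.
set R := \poly_(i < k.+1) c i.
transitivity ((P * (Q * R))`_k).
  rewrite coefM; apply: eq_bigr => i _.
  rewrite coef_poly ltn_ord (@conv_poly _ _ k.+1) //.
  by rewrite ltnS leq_subr.
rewrite mulrA coefM; apply: eq_bigr => i _.
by rewrite [R`_ _]coef_poly ltnS leq_subr (@conv_poly _ _ k.+1).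
Qed.

Lemma pconvP f g : puiseux_support f -> puiseux_support g ->
  puiseux_support (pconv f g).
Proof.
move=> fP gP; have [m [d [d0 [fs gs _]]]] := supp3 fP gP gP.
apply: (@supp_intro (m + m) d) => //.
by rewrite intrD mulrDl; exact: pconv_supp.
Qed.

Lemma pconvC f g : puiseux_support f -> puiseux_support g ->
  pconv f g = pconv g f.
Proof.
move=> fP gP; have [m [d [d0 [fs gs _]]]] := supp3 fP gP gP.
set v := _ / _ in fs gs.
apply: (@supp_ext (v + v) d) => //; try exact: pconv_supp.
move=> k; rewrite !pconvE //.
exact: (convC (fun i => f (v + i%:R / d%:R)) (fun i => g (v + i%:R / d%:R))).
Qed.

Lemma pconvA f g h : puiseux_support f -> puiseux_support g ->
  puiseux_support h -> pconv f (pconv g h) = pconv (pconv f g) h.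
Proof.
move=> fP gP hP; have [m [d [d0 [fs gs hs]]]] := supp3 fP gP hP.
set v := _ / _ in fs gs hs.
have gh := pconv_supp gs hs; have fg := pconv_supp fs gs.
apply: (@supp_ext (v + (v + v)) d) => //; first exact: pconv_supp.
  by rewrite addrA; exact: pconv_supp.
move=> k; rewrite pconvE // addrA pconvE //.
pose a i := f (v + i%:R / d%:R); pose b i := g (v + i%:R / d%:R).
pose c i := h (v + i%:R / d%:R).
rewrite -[RHS]/(\sum_(i < k.+1) _ * c (k - i)%N).
transitivity (conv a (conv b c) k).
  by apply: eq_bigr => i _; rewrite pconvE.
by rewrite convA; apply: eq_bigr => i _; rewrite pconvE.
Qed.

Definition pcst (x : K) (q : rat) : K := if q == 0 then x else 0.

Lemma pcstP x : puiseux_support (pcst x).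
Proof.
exists 1%N, 0; split=> // q; rewrite /pcst; case: (_ =P 0 :> rat) => [-> _|_ /eqP//].
by exists 0; rewrite ?mul0r.
Qed.

Lemma pconv1 f : pconv (pcst 1) f = f.
Proof.
apply/funext => q; rewrite /pconv -(fsbig_widen [set 0]) //.
  by rewrite fsbig_set1 /pcst eqxx mul1r subr0.
by move=> a [_ /eqP a0] /=; rewrite /pcst (negbTE a0) mul0r.
Qed.

Lemma paddP f g : puiseux_support f -> puiseux_support g ->
  puiseux_support (f + g).
Proof.
move=> fP gP; have [m [d [d0 [fs gs _]]]] := supp3 fP gP gP.
apply: (@supp_intro m d) => // q.
have [fq|/fs//] := eqVneq (f q) 0; have [gq|/gs//] := eqVneq (g q) 0.
by rewrite !fctE fq gq addr0 eqxx.
Qed.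

Lemma poppP f : puiseux_support f -> puiseux_support (- f).
Proof.
by move=> [d [m [d0 fs]]]; exists d, m; split=> // q; rewrite oppr_eq0; exact: fs.
Qed.

Lemma pconvDl f g h : puiseux_support f -> puiseux_support g ->
  puiseux_support h -> pconv (f + g) h = pconv f h + pconv g h.
Proof.
move=> fP gP hP; have [m [d [d0 [fs gs hs]]]] := supp3 fP gP hP.
set v := _ / _ in fs gs hs.
have fgs : supp v d (f + g).
  move=> q; have [fq|/fs//] := eqVneq (f q) 0; have [gq|/gs//] := eqVneq (g q) 0.
  by rewrite !fctE fq gq addr0 eqxx.
have fh := pconv_supp fs hs; have gh := pconv_supp gs hs.
apply: (@supp_ext (v + v) d) => //; first exact: pconv_supp.
  move=> q; have [fq|/fh//] := eqVneq (pconv f h q) 0.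
  have [gq|/gh//] := eqVneq (pconv g h q) 0.
  by rewrite !fctE fq gq addr0 eqxx.
move=> k; rewrite [in RHS]fctE !pconvE // -big_split; apply: eq_bigr => i _ /=.
by rewrite !fctE mulrDl.
Qed.

(* Coefficients of the inverse of a power series with constant term a 0,
   by the usual recursion. *)
Fixpoint inv_coefs a (n : nat) : seq K :=
  if n is n'.+1 then
    let s := inv_coefs a n' in
    rcons s ((a 0%N)^-1 * ((n' == 0%N)%:R -
      \sum_(i < n') a (n' - i)%N * s`_i))
  else [::].

Let size_inv_coefs a n : size (inv_coefs a n) = n.
Proof. by elim: n => //= n IH; rewrite size_rcons IH. Qed.

Let nth_inv_coefs a n i : (i < n)%N ->
  (inv_coefs a n)`_i = (inv_coefs a i.+1)`_i.
Proof.
elim: n => // n IH; rewrite ltnS leq_eqVlt => /predU1P[->//|lt_in].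
by rewrite [LHS]nth_rcons size_inv_coefs lt_in IH.
Qed.

Let conv_inv a k : a 0%N != 0 ->
  conv (fun i => (inv_coefs a i.+1)`_i) a k = (k == 0%N)%:R.
Proof.
move=> a0; rewrite /conv big_ord_recr /= nth_rcons size_inv_coefs ltnn eqxx.
rewrite subnn [_ * a 0%N]mulrC mulrA divff // mul1r.
rewrite [X in X + _](eq_bigr (fun i : 'I_k => a (k - i)%N * (inv_coefs a k)`_i)).
  by rewrite addrC subrK.
by move=> i _; rewrite [RHS]mulrC nth_inv_coefs.
Qed.

Lemma pconv_inv_ex f : puiseux_support f -> (exists q, f q != 0) ->
  exists2 g, puiseux_support g & pconv g f = pcst 1.
Proof.
move=> fP [q fq].
have [m [d [d0 [fs _ _]]]] := supp3 fP fP fP.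
have ex : exists k : nat, f (m%:~R / d%:R + k%:R / d%:R) != 0.
  by have [k qE] := fs _ fq; exists k; rewrite -qE.
case: (ex_minnP ex) => k0 fk0 k0_min.
pose v : rat := m%:~R / d%:R + k0%:R / d%:R.
have vE : v = (m + k0)%:~R / d%:R by rewrite intrD mulrDl.
have fv : supp v d f.
  move=> r fr; have [k rE] := fs _ fr.
  have k0k : (k0 <= k)%N by apply: k0_min; rewrite -rE.
  by exists (k - k0)%N; rewrite natrB // rE /v; ring.
pose a i := f (v + i%:R / d%:R).
pose b i := (inv_coefs a i.+1)`_i.
pose g (r : rat) : K := let z := (r + v) * d%:R in
  if z \is a Num.nat then b (Num.truncn z) else 0.
have d0' : d%:R != 0 :> rat by rewrite pnatr_eq0 -lt0n.
have gE k : g (- v + k%:R / d%:R) = b k.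
  rewrite /g; have -> : (- v + k%:R / d%:R + v) * d%:R = k%:R by field.
  by rewrite natr_nat natrK.
have gs : supp (- v) d g.
  move=> r; rewrite /g; case: ifPn => [/natrP[k rE] _|_ /eqP//].
  by exists k; rewrite -rE mulfK //; ring.
have vE' : - v = (- (m + k0))%:~R / d%:R by rewrite vE intrN mulNr.
exists g; first by apply: (@supp_intro (- (m + k0)) d) => //; rewrite -vE'.
apply: (@supp_ext (- v + v) d) => //; first exact: pconv_supp.
  move=> r; rewrite /pcst; case: (_ =P 0 :> rat) => [-> _|_ /eqP//].
  by exists 0%N; rewrite mul0r addr0 addNr.
move=> k; rewrite pconvE //.
transitivity (conv b a k); first by apply: eq_bigr => i _; rewrite gE.
rewrite conv_inv ?/a ?mul0r ?addr0 //.
rewrite /pcst addNr add0r mulf_eq0 invr_eq0 (negbTE d0') orbF pnatr_eq0.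
by case: eqP.
Qed.

End Support.

HB.instance Definition _ (K : fieldType) := gen_eqMixin (puiseux K).
HB.instance Definition _ (K : fieldType) := gen_choiceMixin (puiseux K).

Section PuiseuxField.
Variable K : fieldType.
Implicit Types f g h : puiseux K.

Definition puiseux_cst (x : K) : puiseux K := Puiseux (pcstP x).
Definition puiseux_add f g : puiseux K := Puiseux (paddP (pcoefP f) (pcoefP g)).
Definition puiseux_opp f : puiseux K := Puiseux (poppP (pcoefP f)).
Definition puiseux_mul f g : puiseux K := Puiseux (pconvP (pcoefP f) (pcoefP g)).

Let addA : associative puiseux_add.
Proof. by move=> f g h; apply: puiseux_eqP => q /=; rewrite !fctE addrA. Qed.

Let addC : commutative puiseux_add.
Proof. by move=> f g; apply: puiseux_eqP => q /=; rewrite !fctE addrC. Qed.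

Let add0 : left_id (puiseux_cst 0) puiseux_add.
Proof.
by move=> f; apply: puiseux_eqP => q /=; rewrite !fctE /pcst if_same add0r.
Qed.

Let addN : left_inverse (puiseux_cst 0) puiseux_opp puiseux_add.
Proof.
by move=> f; apply: puiseux_eqP => q /=; rewrite !fctE /pcst if_same addNr.
Qed.

HB.instance Definition _ :=
  GRing.isZmodule.Build (puiseux K) addA addC add0 addN.

Let mulA : associative puiseux_mul.
Proof.
move=> f g h; apply: puiseux_eqP => q /=.
by rewrite pconvA //; exact: pcoefP.
Qed.

Let mulC : commutative puiseux_mul.
Proof.
move=> f g; apply: puiseux_eqP => q /=.
by rewrite pconvC //; exact: pcoefP.
Qed.

Let mul1 : left_id (puiseux_cst 1) puiseux_mul.
Proof. by move=> f; apply: puiseux_eqP => q /=; rewrite pconv1. Qed.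

Let mulDl : left_distributive puiseux_mul puiseux_add.
Proof.
move=> f g h; apply: puiseux_eqP => q /=.
by rewrite pconvDl //; exact: pcoefP.
Qed.

Let one_neq0 : puiseux_cst 1 != puiseux_cst 0.
Proof.
apply/eqP => /(congr1 (fun f : puiseux K => f 0)) /eqP.
by rewrite /= /pcst eqxx oner_eq0.
Qed.

HB.instance Definition _ :=
  GRing.Zmodule_isComNzRing.Build (puiseux K) mulA mulC mul1 mulDl one_neq0.

Definition puiseux_inv f : puiseux K :=
  xget 0 [set g | g * f = 1].

Let mulV f : f != 0 -> puiseux_inv f * f = 1.
Proof.
move=> f0; have [q fq] : exists q, f q != 0.
  apply: contrapT => /forallNP nf; move/eqP: f0; apply.
  apply: puiseux_eqP => q; rewrite /= /pcst if_same.
  by apply/eqP; have /negP := nf q; rewrite negbK.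
have [g gP gf] := pconv_inv_ex (pcoefP f) (ex_intro _ q fq).
have : [set g | g * f = 1] (Puiseux gP).
  by apply: puiseux_eqP => r /=; rewrite gf.
by move=> gE; exact: (@xgetPex _ 0 [set g | g * f = 1] (ex_intro _ _ gE)).
Qed.

Let inv0 : puiseux_inv 0 = 0.
Proof.
rewrite /puiseux_inv; case: xgetP => // g _ /= /eqP.
by rewrite mulr0 eq_sym oner_eq0.
Qed.

HB.instance Definition _ :=
  GRing.ComNzRing_isField.Build (puiseux K) mulV inv0.

End PuiseuxField.

Section Valuation.
Variable K : fieldType.
Implicit Types f : puiseux K.

(* The junk value for f = 0 is 0. *)
Definition pval f : rat :=
  xget 0 [set q | f q != 0 /\ forall r, f r != 0 -> q <= r].

Definition pleadc f : K := f (pval f).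

Lemma pvalP f : f != 0 ->
  f (pval f) != 0 /\ forall q, f q != 0 -> pval f <= q.
Proof.
move=> f0; have [q fq] : exists q, f q != 0.
  apply: contrapT => /forallNP nf; move/eqP: f0; apply.
  apply: puiseux_eqP => q; rewrite /= /pcst if_same.
  by apply/eqP; have /negP := nf q; rewrite negbK.
have [d [m [d0 fs]]] := pcoefP f.
have fsk r : f r != 0 -> exists k : nat, r = (m + k%:Z)%:~R / d%:R.
  move=> /fs[k mk ->]; exists `|(k - m)%R|%N.
  by rewrite gez0_abs ?subr_ge0 // addrC subrK.
have ex : exists k : nat, f ((m + k%:Z)%:~R / d%:R) != 0.
  by have [k qE] := fsk _ fq; exists k; rewrite -qE.
case: (ex_minnP ex) => k0 fk0 k0_min.
apply: (@xgetPex _ 0 [set q | f q != 0 /\ forall r, f r != 0 -> q <= r]).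
exists ((m + k0%:Z)%:~R / d%:R); split=> // r fr.
have [k rE] := fsk _ fr; rewrite rE.
rewrite ler_pM2r ?invr_gt0 ?ltr0n // ler_int lerD2l lez_nat.
by apply: k0_min; rewrite -rE.
Qed.

End Valuation.

Section Map.
Variables (K L : fieldType) (phi : {rmorphism K -> L}).

Lemma pmapP (f : puiseux K) : puiseux_support (phi \o f).
Proof.
have [d [m [d0 fs]]] := pcoefP f; exists d, m; split=> // q.
by rewrite /= fmorph_eq0; exact: fs.
Qed.

Definition puiseux_map (f : puiseux K) : puiseux L := Puiseux (pmapP f).

End Map.

(* For K = R[i] the order is the partial order of the complex numbers, so that
   0 < z means that z is a positive real number. The zero series is excluded,
   since its coefficients all vanish. *)
Definition positive_leadc (K : numFieldType) : set (puiseux K) :=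
  [set f | 0 < pleadc f].

Definition Cplus (R : realType) : set (puiseux R[i]) :=
  @positive_leadc R[i].

(* R^+, as a subset of the field of complex Puiseux series. *)
Definition Rplus (R : realType) : set (puiseux R[i]) :=
  puiseux_map (real_complex R) @` @positive_leadc R.

Definition pval_mx (R : realType) (m n : nat)
    (A : 'M[puiseux R[i]]_(m, n)) : 'M[R]_(m, n) :=
  \matrix_(i, j) ratr (pval (A i j)).

(* The affine space of dimension m * n over the Puiseux series is taken to be
   the space of matrices; P plays the role of C^+ or R^+. *)
Definition trop (R : realType) (P : set (puiseux R[i])) (m n : nat)
    (X : set 'M[puiseux R[i]]_(m, n)) : set 'M[R]_(m, n) :=
  closure [set pval_mx A | A in [set A | X A /\ forall i j, P (A i j)]].

Definition singular_matrices (R : realType) (n : nat) :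
    set 'M[puiseux R[i]]_n :=
  [set A | \det A = 0].

Definition trop_weight (R : realType) (n : nat) (M : 'M[R]_n) (s : 'S_n) : R :=
  \sum_i M i (s i).

(* The minimum over all permutations; starting from the identity is harmless. *)
Definition tropdet (R : realType) (n : nat) (M : 'M[R]_n) : R :=
  \big[Num.min/trop_weight M 1%g]_(s : 'S_n) trop_weight M s.

(* Main.v *)
From HB Require Import structures.
From mathcomp Require Import ring lra.
Require Import Defs.

Set Implicit Arguments.
Unset Strict Implicit.
Unset Printing Implicit Defensive.

Import Order.TTheory GRing.Theory Num.Theory.
Import numFieldNormedType.Exports.
Local Open Scope classical_set_scope.
Local Open Scope ring_scope.

(* Given two minimizing permutations of opposite signs, a small perturbation of
   [M] makes it rational with exactly two minimizers, still of opposite signs.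
   For such a matrix take the entries [t ^ Q i j], except one lying on only one
   of the two permutations, for which the linear equation [det = 0] is solved:
   the two dominant terms balance, so the solution has the prescribed valuation
   and leading coefficient 1. Conversely, if a matrix over C^+ is singular then
   the lowest terms of its determinant cancel, which is impossible when all
   minimizers have the same sign. *)

Lemma perm_neqP (T : finType) (s t : {perm T}) : s != t -> exists x, s x != t x.
Proof.
move=> st; apply/existsP; apply: contraNT st => /existsPn st.
by apply/eqP/permP => x; apply/eqP/negPn/st.
Qed.

(** * Lowest-order terms of Puiseux series *)

Section Initial.
Variable K : fieldType.
Implicit Types (f g : puiseux K) (p q : rat) (c d : K).

Lemma puiseux0E q : (0 : puiseux K) q = 0.
Proof. by rewrite /= /pcst if_same. Qed.

Lemma puiseuxD f g q : (f + g) q = f q + g q.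
Proof. by []. Qed.

Lemma puiseuxN f q : (- f) q = - f q.
Proof. by []. Qed.

Lemma puiseux_sum (I : Type) (r : seq I) (P : pred I) (F : I -> puiseux K) q :
  (\sum_(i <- r | P i) F i) q = \sum_(i <- r | P i) F i q.
Proof.
exact: (big_morph (fun f : puiseux K => f q) (fun f g => puiseuxD f g q)
  (puiseux0E q)).
Qed.

(** [c] may be zero, and then [q] is only a strict lower bound for the support. Terms of higher
    order and sums with cancellation thus fit the same predicate. *)
Definition initial q c f := (forall r, r < q -> f r = 0) /\ f q = c.

(** In the convolution at an exponent up to [p + q], an index below [p] kills the factor from [f]
    and one above [p] the factor from [g]; only [a = p] at [p + q] itself survives. *)
Lemma initialM p q c d f g : initial p c f -> initial q d g ->
  initial (p + q) (c * d) (f * g).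
Proof.
move=> [f0 fp] [g0 gq]; split=> [r rpq|].
  rewrite [LHS]/(pconv f g r) /pconv fsbig1 // => a _.
  have [ap|pa] := ltP a p; first by rewrite f0 ?mul0r.
  by rewrite g0 ?mulr0 // ltrBlDl (lt_le_trans rpq) // lerD2r.
rewrite [LHS]/(pconv f g _) /pconv -(fsbig_widen [set p]) //.
  by rewrite fsbig_set1 fp addrAC subrr add0r gq.
move=> a [_ /= /eqP]; case: ltgtP => // [ap|pa] _.
  by rewrite f0 ?mul0r.
by rewrite g0 ?mulr0 // ltrBlDr [p + q]addrC ltrD2l.
Qed.

Lemma initial1 : initial 0 1 (1 : puiseux K).
Proof.
split=> [r r0|]; rewrite [LHS]/(pcst 1 _) /pcst ?eqxx //.
by rewrite lt_eqF.
Qed.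

Lemma initialN q c f : initial q c f -> initial q (- c) (- f).
Proof.
by move=> [f0 fq]; split=> [r /f0 fr|]; rewrite puiseuxN ?fq // fr oppr0.
Qed.

Lemma initial_sign (b : bool) : initial 0 ((-1) ^+ b) ((-1) ^+ b : puiseux K).
Proof. by case: b; [exact: initialN initial1|exact: initial1]. Qed.

Lemma initial_prod (I : Type) (r : seq I) (P : pred I) (F : I -> puiseux K)
    (w : I -> rat) (c : I -> K) :
  (forall i, P i -> initial (w i) (c i) (F i)) ->
  initial (\sum_(i <- r | P i) w i) (\prod_(i <- r | P i) c i)
    (\prod_(i <- r | P i) F i).
Proof.
move=> H; elim/big_rec3: _ => [|i x y z Pi xyz]; first exact: initial1.
by apply: initialM => //; exact: H.
Qed.

Lemma initial_sum (I : Type) (r : seq I) (P : pred I) (F : I -> puiseux K)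
    q (c : I -> K) :
  (forall i, P i -> initial q (c i) (F i)) ->
  initial q (\sum_(i <- r | P i) c i) (\sum_(i <- r | P i) F i).
Proof.
move=> H; split=> [s sq|]; rewrite puiseux_sum.
  by apply: big1 => i /H[F0 _]; exact: F0.
by apply: eq_bigr => i /H[].
Qed.

Lemma initial_lt p q c f : initial q c f -> p < q -> initial p 0 f.
Proof.
by move=> [f0 _] pq; split=> [r rp|]; apply: f0 => //; exact: lt_trans pq.
Qed.

Lemma initial_neq0 q c f : c != 0 -> initial q c f -> f != 0.
Proof.
by move=> c0 [_ fq]; apply: contraNneq c0 => f0; rewrite -fq f0 puiseux0E.
Qed.

Lemma initial_val f : f != 0 -> initial (pval f) (pleadc f) f.
Proof.
move=> /pvalP[_ vmin]; split=> // r; rewrite ltNge.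
by apply: contraNeq => /vmin.
Qed.

Lemma initial_uniq p q c d f : c != 0 -> d != 0 ->
  initial p c f -> initial q d f -> p = q /\ c = d.
Proof.
move=> c0 d0 [fp0 fp] [fq0 fq]; have [pq|pq|pq] := ltgtP p q.
- by move: c0; rewrite -fp fq0 ?eqxx.
- by move: d0; rewrite -fq fp0 ?eqxx.
- by rewrite -fp -fq pq.
Qed.

Lemma initial_pval q c f : c != 0 -> initial q c f -> pval f = q.
Proof.
move=> c0 fi; have f0 := initial_neq0 c0 fi.
by have [] := initial_uniq (pvalP f0).1 c0 (initial_val f0) fi.
Qed.

Lemma initial_pleadc q c f : c != 0 -> initial q c f -> pleadc f = c.
Proof. by move=> c0 fi; rewrite /pleadc (initial_pval c0 fi); case: fi. Qed.

(** The product of [f] and [f^-1] has initial term 1 at exponent 0, so uniqueness of initial terms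
    dictates the exponent and coefficient of [f^-1]. *)
Lemma initialV q c f : c != 0 -> initial q c f -> initial (- q) c^-1 f^-1.
Proof.
move=> c0 fi; have f0 := initial_neq0 c0 fi.
have fV : f^-1 != 0 by rewrite invr_eq0.
have := initialM fi (initial_val fV); rewrite divff // => fi1.
have cV : c * pleadc f^-1 != 0 by rewrite mulf_neq0 //; exact: (pvalP fV).1.
have [qE cE] := initial_uniq cV (oner_neq0 K) fi1 initial1.
have <- : pleadc f^-1 = c^-1 by apply: (mulfI c0); rewrite cE divff.
have <- : pval f^-1 = - q by apply/eqP; rewrite -addr_eq0 addrC qE.
exact: initial_val.
Qed.

Lemma pmonomP q : puiseux_support (fun r => pcst (1 : K) (r - q)).
Proof.
exists `|denq q|%N, (numq q); split; first by rewrite absz_gt0 denq_neq0.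
move=> r; rewrite /pcst subr_eq0.
have [-> _|_] := eqVneq r q; last by rewrite eqxx.
by exists (numq q) => //; rewrite pmulrn gtz0_abs // divq_num_den.
Qed.

Definition pmonom q : puiseux K := Puiseux (pmonomP q).

Lemma initial_pmonom q : initial q 1 (pmonom q).
Proof.
split=> [r rq|] /=; rewrite /pcst subr_eq0 ?eqxx //.
by rewrite lt_eqF.
Qed.

End Initial.

(** * Leibniz terms and a singular lift for two strict minimizers *)

Section Determinant.
Variables (K : fieldType) (n : nat).

(** The counterpart of [trop_weight] for rational exponents; [trop_weight_ratr] links the two. *)
Definition perm_weight (V : zmodType) (Q : 'M[V]_n) (s : 'S_n) : V :=
  \sum_i Q i (s i).

Lemma initial_det_term (A : 'I_n -> 'I_n -> puiseux K) (Q : 'M[rat]_n)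
    (c : 'I_n -> 'I_n -> K) s :
  (forall i j, initial (Q i j) (c i j) (A i j)) ->
  initial (perm_weight Q s) ((-1) ^+ s * \prod_i c i (s i))
    ((-1) ^+ s * \prod_i A i (s i)).
Proof.
move=> AQ; rewrite -[perm_weight Q s]add0r; apply: initialM.
  exact: initial_sign.
exact: initial_prod.
Qed.

(* The determinant is [x * G + H] in an entry [x] lying on [s1] but not on [s2],
   and the unique minimizers make [G] and [H] have opposite leading
   coefficients. *)
Lemma singular_lift (Q : 'M[rat]_n) (s1 s2 : 'S_n) :
  odd_perm s1 != odd_perm s2 -> perm_weight Q s1 = perm_weight Q s2 ->
  (forall s, s != s1 -> s != s2 -> perm_weight Q s1 < perm_weight Q s) ->
  exists2 A : 'M[puiseux K]_n, \det A = 0 &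
    forall i j, initial (Q i j) 1 (A i j).
Proof.
move=> s12 w12 wlt; set w := perm_weight Q s1 in w12 wlt.
have [i0 i0P] : exists i, s1 i != s2 i.
  by apply: perm_neqP; apply: contraNneq s12 => ->.
pose T i j := pmonom K (Q i j).
have sgnE s : initial (perm_weight Q s) ((-1) ^+ s)
    ((-1) ^+ s * \prod_i T i (s i)).
  have := @initial_det_term T Q (fun _ _ => 1) s.
  rewrite prodr_const expr1n mulr1; apply => i j; exact: initial_pmonom.
(* All Leibniz terms are read at the common exponent [w], where only [s1] and [s2] contribute. *)
have atw s : initial w (if (s == s1) || (s == s2) then (-1) ^+ s else 0)
    ((-1) ^+ s * \prod_i T i (s i)).
  have [->|ns1] /= := eqVneq s s1; first exact: sgnE.
  have [->|ns2] /= := eqVneq s s2; first by rewrite w12; exact: sgnE.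
  exact: initial_lt (sgnE s) (wlt _ ns1 ns2).
pose j0 := s1 i0.
pose H := \sum_(s : 'S_n | s i0 != j0) (-1) ^+ s * \prod_i T i (s i).
pose G :=
  \sum_(s : 'S_n | s i0 == j0) (-1) ^+ s * \prod_(i | i != i0) T i (s i).
have detE x :
    \det (\matrix_(i, j) if (i == i0) && (j == j0) then x else T i j) =
    x * G + H.
  rewrite /determinant (bigID (fun s : 'S_n => s i0 == j0)) /=; congr (_ + _).
    rewrite big_distrr /=; apply: eq_bigr => s /eqP si0.
    rewrite (bigD1 i0) //= mxE eqxx si0 eqxx mulrCA; congr (_ * (_ * _)).
    by apply: eq_bigr => i /negbTE ni; rewrite mxE ni.
  apply: eq_bigr => s /negbTE si0; congr (_ * _); apply: eq_bigr => i _.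
  by rewrite mxE; case: eqP => [->|//]; rewrite si0.
have HP : initial w ((-1) ^+ s2) H.
  have := @initial_sum K _ (index_enum 'S_n) (fun s => s i0 != j0) _ w _
    (fun s _ => atw s).
  rewrite (bigD1 s2) /=; last by rewrite eq_sym.
  rewrite eqxx orbT big1 ?addr0 // => s /andP[si0 /negbTE ->].
  by have [sE|//] := eqVneq s s1; rewrite sE eqxx in si0.
(* Restoring the omitted factor [T i0 j0] turns [G] into a sum of full Leibniz terms, of which only
   that of [s1] reaches [w]; the factor is divided out afterwards. *)
have TG : initial w ((-1) ^+ s1) (T i0 j0 * G).
  rewrite /G big_distrr /=.
  have := @initial_sum K _ (index_enum 'S_n) (fun s => s i0 == j0) _ w _
    (fun s _ => atw s).
  rewrite (bigD1 s1) //= eqxx big1 ?addr0 => [|s /andP[/eqP si0 /negbTE ->]].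
    congr initial; apply: eq_bigr => s /eqP si0.
    by rewrite [in LHS](bigD1 i0) //= si0 mulrCA.
  by have [sE|//] := eqVneq s s2; rewrite -sE si0 eqxx in i0P.
have Ti := initial_pmonom K (Q i0 j0).
have GP : initial (w - Q i0 j0) ((-1) ^+ s1) G.
  have T0 := initial_neq0 (oner_neq0 K) Ti.
  have := initialM (initialV (oner_neq0 K) Ti) TG.
  by rewrite invr1 mul1r mulrA mulVf // mul1r addrC.
have sgn0 b : (-1) ^+ b != 0 :> K by rewrite signr_eq0.
have G0 := initial_neq0 (sgn0 _) GP.
exists (\matrix_(i, j) if (i == i0) && (j == j0) then - H / G else T i j).
  by rewrite detE divfK // addNr.
move=> i j; rewrite mxE; case: ifP => [/andP[/eqP-> /eqP->]|_]; last first.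
  exact: initial_pmonom.
(* The leading coefficient of [- H / G] is minus the product of the two signs, hence 1. *)
have := initialM (initialN HP) (initialV (sgn0 _) GP).
rewrite opprB addrC subrK; congr initial.
rewrite invr_sign mulNr -signr_addb.
by move: s12; case: (odd_perm s1); case: (odd_perm s2) => //= _;
  rewrite expr1 opprK.
Qed.

End Determinant.

(** * Cancellation under positive leading coefficients *)

Section Positive.
Variables (K : numFieldType) (n : nat).

Lemma pleadc_gt0_neq0 (f : puiseux K) : 0 < pleadc f -> f != 0.
Proof. by apply: contraTneq => ->; rewrite /pleadc puiseux0E ltxx. Qed.

Lemma singular_pos_minimizers (A : 'M[puiseux K]_n) :
  \det A = 0 -> (forall i j, 0 < pleadc (A i j)) ->
  let Q : 'M[rat]_n := \matrix_(i, j) pval (A i j) in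
  exists s1 s2 : 'S_n, [/\ forall s, perm_weight Q s1 <= perm_weight Q s,
    forall s, perm_weight Q s2 <= perm_weight Q s & odd_perm s1 != odd_perm s2].
Proof.
move=> detA Apos Q.
have AP i j : initial (Q i j) (pleadc (A i j)) (A i j).
  by rewrite mxE; apply: initial_val; exact: pleadc_gt0_neq0.
pose c (s : 'S_n) := \prod_i pleadc (A i (s i)).
have cpos s : 0 < c s by apply: prodr_gt0.
have tP s : initial (perm_weight Q s) ((-1) ^+ s * c s)
    ((-1) ^+ s * \prod_i A i (s i)) := initial_det_term s AP.
case: (arg_minP (perm_weight Q) (isT : xpredT (1%g : 'S_n))) => s1 _ s1P.
have {}s1P s := s1P s isT.
apply: contrapT => H.
have same s : perm_weight Q s = perm_weight Q s1 -> odd_perm s = odd_perm s1.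
  move=> ws; apply/eqP; apply: contrapT => /negP ns; apply: H.
  by exists s, s1; split => // t; rewrite ws.
(* With the common sign pulled out, the coefficient of the determinant at the minimal weight is a
   sum of nonnegative terms including [c s1 > 0], so it cannot vanish. *)
have atw s : initial (perm_weight Q s1)
    ((-1) ^+ s1 * if perm_weight Q s == perm_weight Q s1 then c s else 0)
    ((-1) ^+ s * \prod_i A i (s i)).
  case: eqP => [ws|/eqP ws]; first by rewrite -ws -(same _ ws).
  by rewrite mulr0; apply: initial_lt (tP s) _; rewrite lt_neqAle eq_sym ws s1P.
have := @initial_sum K _ (index_enum 'S_n) predT _ _ _ (fun s _ => atw s).
rewrite -/(determinant A) detA -big_distrr /= => -[_].
rewrite puiseux0E => /esym/eqP; rewrite mulf_eq0 signr_eq0 /=; apply/negP.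
rewrite gt_eqF // (bigD1 s1) //= eqxx ltr_wpDr //.
by apply: sumr_ge0 => s _; case: ifP => // _; exact: ltW.
Qed.

End Positive.

(** * Coefficientwise field morphisms on Puiseux series *)

Section MapMorphism.
Variables (K L : fieldType) (phi : {rmorphism K -> L}).

Let map_additive : {morph puiseux_map phi : f g / f - g}.
Proof. by move=> f g; apply: puiseux_eqP => q; rewrite /= rmorphB. Qed.

Let map_multiplicative : monoid_morphism (puiseux_map phi).
Proof.
split=> [|f g]; apply: puiseux_eqP => q.
  by rewrite /= /pcst; case: ifP => _; rewrite ?rmorph1 ?rmorph0.
rewrite /= /pconv rmorph_sum; under eq_bigr do rewrite rmorphM.
(* Both sums run over the supports of their summands; these coincide because [phi] is injective. *)
congr (\big[_/_]_(i <- _) _); rewrite /finite_support !unlock.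
congr (finmap.enum_fset (fset_set _)).
apply/seteqP; split=> a [_] /= h; split=> // /eqP.
  by rewrite -rmorphM fmorph_eq0 => /eqP.
by move=> /eqP h0; apply: h; rewrite -rmorphM h0 rmorph0.
Qed.

HB.instance Definition _ := GRing.isZmodMorphism.Build
  (puiseux K) (puiseux L) (puiseux_map phi) map_additive.
HB.instance Definition _ := GRing.isMonoidMorphism.Build
  (puiseux K) (puiseux L) (puiseux_map phi) map_multiplicative.

Lemma initial_map q c (f : puiseux K) :
  initial q c f -> initial q (phi c) (puiseux_map phi f).
Proof. by move=> [f0 fq]; split=> [r /f0 fr|] /=; rewrite ?fr ?fq ?rmorph0. Qed.

End MapMorphism.

(** * Perturbation to a rational matrix with exactly two minimizers *)

Section Perturbation.
Variables (R : realType) (n : nat).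
Implicit Types (M : 'M[R]_n) (s : 'S_n).

Definition minimizer M s := forall s', trop_weight M s <= trop_weight M s'.

Lemma tropdet_minimizer M s : trop_weight M s = tropdet M -> minimizer M s.
Proof. by rewrite /minimizer => -> s'; exact: bigmin_le. Qed.

Definition strict_pair M (s1 s2 : 'S_n) := [/\ odd_perm s1 != odd_perm s2,
  trop_weight M s1 = trop_weight M s2 &
  forall s, s != s1 -> s != s2 -> trop_weight M s1 < trop_weight M s].

(* Raising the entries off the graphs of two minimizers of opposite signs leaves
   only those two if they agree in as many places as possible: a third minimizer
   supported on the two graphs would agree more with the one of opposite sign. *)
Lemma strict_pair_near M s1 s2 e : 0 < e ->
  minimizer M s1 -> minimizer M s2 -> odd_perm s1 != odd_perm s2 ->
  exists M' t1 t2, strict_pair M' t1 t2 /\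
    forall i j, `|M i j - M' i j| <= e.
Proof.
move=> e0 m1 m2 s12.
pose P (p : 'S_n * 'S_n) := [&& `[< minimizer M p.1 >], `[< minimizer M p.2 >]
  & odd_perm p.1 != odd_perm p.2].
pose N (p : 'S_n * 'S_n) := #|[pred i | p.1 i == p.2 i]|.
have P12 : P (s1, s2) by apply/and3P; split => //; exact/asboolP.
case: (arg_maxnP N P12) => -[t1 t2] /and3P[/= /asboolP mt1 /asboolP mt2 t12] tmax.
pose D i j : R := if (j == t1 i) || (j == t2 i) then 0 else e.
have D0 i j : 0 <= D i j by rewrite /D; case: ifP => // _; exact: ltW.
exists (M + \matrix_(i, j) D i j), t1, t2.
have wE s : trop_weight (M + \matrix_(i, j) D i j) s =
    trop_weight M s + \sum_i D i (s i).
  by rewrite /trop_weight -big_split; apply: eq_bigr => i _; rewrite !mxE.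
have D1 : \sum_i D i (t1 i) = 0 by apply: big1 => i _; rewrite /D eqxx.
have D2 : \sum_i D i (t2 i) = 0 by apply: big1 => i _; rewrite /D eqxx orbT.
have w12 : trop_weight M t1 = trop_weight M t2.
  by apply/eqP; rewrite eq_le mt1 mt2.
have DS s : 0 <= \sum_i D i (s i) by apply: sumr_ge0.
split; last first.
  move=> i j; rewrite !mxE opprD addrA subrr add0r normrN ger0_norm //.
  by rewrite /D; case: ifP => // _; exact: ltW.
split=> //; first by rewrite !wE D1 D2 w12.
move=> s st1 st2; rewrite !wE D1 addr0.
have [ws|ws] := ltP (trop_weight M t1) (trop_weight M s).
  by rewrite (lt_le_trans ws) // lerDl.
have ms : minimizer M s by move=> s'; apply: le_trans ws (mt1 s').
suff [i si] : exists i, ~~ ((s i == t1 i) || (s i == t2 i)).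
  rewrite (le_lt_trans (mt1 s)) // ltrDl (bigD1 i) //= ltr_wpDr //.
    exact: sumr_ge0.
  by rewrite /D (negbTE si).
apply/existsP; rewrite -negb_forall; apply/negP => /forallP sD.
(* Where [u] and [v] agree, [s] has the same value; where [s] leaves [v], it follows [u] and gives
   one more agreement. *)
have agree (u v : 'S_n) : s != v -> (forall i, s i = u i \/ s i = v i) ->
    (N (u, v) < N (s, u))%N.
  move=> sv suv; apply: proper_card; apply/properP; split.
    apply/fintype.subsetP => i; rewrite !inE /= => /eqP uv.
    by case: (suv i) => ->; rewrite uv.
  have [i si] := perm_neqP sv.
  have su : s i = u i by case: (suv i) => // sve; rewrite sve eqxx in si.
  by exists i; rewrite inE /= -su ?eqxx.
have n1 : (N (t1, t2) < N (s, t1))%N.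
  by apply: agree => // i; have /orP[/eqP|/eqP] := sD i; [left|right].
have n2 : (N (t1, t2) < N (s, t2))%N.
  have -> : N (t1, t2) = N (t2, t1) by apply: eq_card => i; rewrite !inE eq_sym.
  by apply: agree => // i; have /orP[/eqP|/eqP] := sD i; [right|left].
(* By maximality of [N (t1, t2)], the closer pair [(s, u)] cannot have opposite signs; applied to
   [t1] and [t2], this contradicts [t12]. *)
have same u : minimizer M u -> (N (t1, t2) < N (s, u))%N ->
    odd_perm s = odd_perm u.
  move=> mu ltN; apply/eqP/negPn; apply: contraL ltN => su; rewrite -leqNgt.
  by apply: (tmax (s, u)); apply/and3P; split => //; exact/asboolP.
by rewrite -(same _ mt1 n1) (same _ mt2 n2) eqxx in t12.
Qed.

Lemma rat_near (x e : R) : 0 < e -> exists q : rat, `|x - ratr q| < e.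
Proof.
move=> e0; have /rat_in_itvoo[q] : x - e < x + e by rewrite ltrD2l gtrN.
by rewrite in_itv /= => qx; exists q; rewrite distrC ltr_distl.
Qed.

Lemma trop_weight_ratr (Q : 'M[rat]_n) s :
  trop_weight (\matrix_(i, j) ratr (Q i j) : 'M[R]_n) s =
  ratr (perm_weight Q s).
Proof. by rewrite rmorph_sum; apply: eq_bigr => i _; rewrite mxE. Qed.

(** Rational approximation keeps the strict inequalities but may break the equality of the two
    weights. That equality is linear with integer coefficients, so it can be restored by solving for
    one entry. *)
Lemma strict_pair_rat_near M s1 s2 e : 0 < e -> strict_pair M s1 s2 ->
  exists2 Q : 'M[rat]_n, strict_pair (\matrix_(i, j) ratr (Q i j)) s1 s2 &
    forall i j, `|M i j - ratr (Q i j)| < e.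
Proof.
move=> e0 [s12 w12 wlt].
have [i0 i0P] : exists i, s1 i != s2 i.
  by apply: perm_neqP; apply: contraNneq s12 => ->.
have [g g0 gap] : exists2 g, 0 < g & forall s, s != s1 -> s != s2 ->
    trop_weight M s1 + g <= trop_weight M s.
  (* The default [1] keeps the gap positive when no other permutation exists. *)
  exists (\big[Num.min/1]_(s | (s != s1) && (s != s2))
    (trop_weight M s - trop_weight M s1)).
    by apply: lt_bigmin => // s /andP[? ?]; rewrite subr_gt0 wlt.
  move=> s n1 n2; rewrite addrC -lerBrDr; apply: bigmin_le_cond.
  by rewrite n1.
have n0 : 0 < n%:R :> R.
  by rewrite ltr0n; case: (n) i0 {s12 w12 wlt gap i0P} => [[]|].
(* Entry errors below [h] move each weight by at most [g / 3], so two weights at distance [g] stay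
   in order. The solved entry combines [2n - 1] approximations, whence [d = h / (2n)]. *)
pose h := Num.min e (g / (n%:R *+ 3)).
have h0 : 0 < h by rewrite lt_min e0 divr_gt0 // pmulrn_lgt0.
pose d := h / (n%:R *+ 2).
have d0 : 0 < d by rewrite divr_gt0 // pmulrn_lgt0.
have [q qP] := choice (fun ij : 'I_n * 'I_n => rat_near (M ij.1 ij.2) d0).
pose j0 := s1 i0.
pose x := \sum_i q (i, s2 i) - \sum_(i | i != i0) q (i, s1 i).
pose Q : 'M[rat]_n :=
  \matrix_(i, j) if (i == i0) && (j == j0) then x else q (i, j).
have wQ : perm_weight Q s1 = perm_weight Q s2.
  rewrite /perm_weight (bigD1 i0) //= mxE !eqxx /x.
  rewrite [X in _ + X](eq_bigr (fun i => q (i, s1 i))); last first.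
    by move=> i /negbTE ni; rewrite mxE ni.
  rewrite subrK; apply: eq_bigr => i _; rewrite mxE; case: eqP => //= ->.
  by rewrite eq_sym (negbTE i0P).
have dn : d *+ n *+ 2 = h.
  by rewrite -mulrnA -mulr_natr natrM mulr_natr divfK // gt_eqF // pmulrn_lgt0.
have QP i j : `|M i j - ratr (Q i j)| < h.
  rewrite mxE; case: ifP => [/andP[/eqP-> /eqP->]|_]; last first.
    apply: lt_le_trans (qP (i, j)) _; rewrite -dn -mulrnA -[leLHS]mulr1n.
    by rewrite ler_pMn2l // muln_gt0 -(ltr0n R) n0.
  have -> : M i0 j0 = \sum_i M i (s2 i) - \sum_(i | i != i0) M i (s1 i).
    by move: w12; rewrite /trop_weight (bigD1 i0) //= => <-; rewrite addrK.
  have -> : ratr x = \sum_i ratr (q (i, s2 i)) -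
      \sum_(i | i != i0) ratr (q (i, s1 i)) :> R.
    by rewrite rmorphB !rmorph_sum.
  rewrite opprD addrACA -opprD -!sumrB (le_lt_trans (ler_normB _ _)) //.
  have dsum : \sum_(i < n) d = d *+ n by rewrite sumr_const card_ord.
  rewrite -dn mulr2n -dsum ler_ltD //.
    apply: le_trans (ler_norm_sum _ _ _) (ler_sum _ _) => k _.
    exact: ltW (qP (k, s2 k)).
  rewrite [ltRHS](bigD1 i0) //= -[ltLHS]add0r ltr_leD //.
  apply: le_trans (ler_norm_sum _ _ _) (ler_sum _ _) => k _.
  exact: ltW (qP (k, s1 k)).
exists Q; last by move=> i j; apply: lt_le_trans (QP i j) _; rewrite ge_min lexx.
split=> //; first by rewrite !trop_weight_ratr wQ.
have wQh s : `|trop_weight M s - trop_weight (\matrix_(i, j) ratr (Q i j)) s| <=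
    g / 3.
  rewrite -sumrB; apply: le_trans (ler_norm_sum _ _ _) _.
  apply: le_trans (_ : \sum_(i < n) g / (n%:R *+ 3) <= _).
    apply: ler_sum => i _; rewrite mxE; apply: le_trans (ltW (QP i _)) _.
    by rewrite ge_min lexx orbT.
  rewrite sumr_const card_ord -[leLHS]mulr_natr -[n%:R *+ 3]mulr_natr.
  by rewrite le_eqVlt; apply/orP; left; apply/eqP; field; rewrite gt_eqF.
move=> s n1 n2; have := gap s n1 n2; have := wQh s; have := wQh s1.
rewrite !ler_distl => /andP[? ?] /andP[? ?] ?; lra.
Qed.

End Perturbation.

(** * Lifts over the positive reals and passage to the closure *)

Section Lifting.
Variables (R : realType) (n : nat).
Implicit Types (M : 'M[R]_n).

Lemma Rplus_sub_Cplus : @Rplus R `<=` @Cplus R.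
Proof.
move=> _ [f fpos <-]; have f0 := pleadc_gt0_neq0 fpos.
have /(initial_map (real_complex R)) fi := initial_val f0.
rewrite /Cplus /positive_leadc /mkset (initial_pleadc _ fi) ?ltcR //.
by rewrite fmorph_eq0; have [] := pvalP f0.
Qed.

(** The lift is built over [R], where leading coefficient 1 gives positivity, and then embedded
    coefficientwise; this ring morphism commutes with the determinant and keeps valuations. *)
Lemma trop_strict_pair (Q : 'M[rat]_n) s1 s2 :
  strict_pair (\matrix_(i, j) ratr (Q i j) : 'M[R]_n) s1 s2 ->
  [set pval_mx A | A in
    [set A | @singular_matrices R n A /\ forall i j, Rplus (A i j)]]
    (\matrix_(i, j) ratr (Q i j)).
Proof.
move=> [s12]; rewrite !trop_weight_ratr => /fmorph_inj w12 wlt.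
have [|A A0 AQ] := @singular_lift R n Q s1 s2 s12 w12.
  by move=> s n1 n2; have := wlt s n1 n2; rewrite !trop_weight_ratr ltr_rat.
have one0 : 1 != 0 :> R by rewrite oner_eq0.
exists (map_mx (puiseux_map (real_complex R)) A).
  split; first by rewrite /singular_matrices /= det_map_mx A0 rmorph0.
  move=> i j; rewrite mxE; exists (A i j) => //.
  by rewrite /positive_leadc /= (initial_pleadc one0 (AQ i j)).
apply/matrixP => i j; rewrite !mxE.
by rewrite (initial_pval _ (initial_map (real_complex R) (AQ i j))) ?fmorph_eq0.
Qed.

Lemma trop_minimizers M s1 s2 : minimizer M s1 -> minimizer M s2 ->
  odd_perm s1 != odd_perm s2 -> trop (@Rplus R) (@singular_matrices R n) M.
Proof.
move=> m1 m2 s12 B /nbhs_ballP[e /= e0 eB].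
have e2 : 0 < e / 2 by rewrite divr_gt0.
have [M' [t1 [t2 [pair near1]]]] := strict_pair_near e2 m1 m2 s12.
have [Q Qpair near2] := strict_pair_rat_near e2 pair.
exists (\matrix_(i, j) ratr (Q i j)); split; first exact: trop_strict_pair Qpair.
apply: eB; split=> // i j; rewrite mxE -ball_normE /=.
rewrite -(subrKA (M' i j)) (le_lt_trans (ler_normD _ _)) // (splitr e).
exact: ler_ltD.
Qed.

End Lifting.

Theorem theorem4p1 (R : realType) (n : nat) :
  (forall M : 'M[R]_n,
     (exists s1 s2 : 'S_n,
        [/\ trop_weight M s1 = tropdet M,
            trop_weight M s2 = tropdet M &
            odd_perm s1 != odd_perm s2]) ->
     trop (@Rplus R) (@singular_matrices R n) M) /\
  trop (@Cplus R) (@singular_matrices R n) =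
  trop (@Rplus R) (@singular_matrices R n).
Proof.
split.
  move=> M [s1 [s2 [/tropdet_minimizer m1 /tropdet_minimizer m2 s12]]].
  exact: trop_minimizers m1 m2 s12.
apply/seteqP; split; last first.
  apply: closureS => _ [A [A0 AR] <-]; exists A => //.
  by split=> // i j; exact: Rplus_sub_Cplus.
(* Since the target is closed, only valuation matrices of actual singular matrices over [Cplus] need
   to be treated. *)
have : closed (trop (@Rplus R) (@singular_matrices R n)) by exact: closed_closure.
move=> /closure_id ->; apply: closureS => _ [A [A0 AC] <-].
have [s1 [s2 [m1 m2 s12]]] := singular_pos_minimizers A0 AC.
have wE s : trop_weight (pval_mx A) s =
    ratr (perm_weight (\matrix_(i, j) pval (A i j)) s).
  by rewrite -trop_weight_ratr; apply: eq_bigr => i _; rewrite !mxE.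
by apply: trop_minimizers s12 => s; rewrite !wE ler_rat.
Qed.
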